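(* Let $\pi$ be a fixed stationary deterministic policy of a finite Markov decision process with state space $\mathcal S$, let $P_\pi$ be the induced transition matrix, $r_\pi$ the induced reward vector with non-negative entries, $\gamma\in[0,1)$ the discount factor, and $v_\pi$ the value function. Decompose $\mathcal S=\mathcal T_1\cup\cdots\cup\mathcal T_m\cup\mathcal R_1\cup\cdots\cup\mathcal R_\ell$ into the transient communicating classes $\mathcal T_j$ and the recurrent communicating classes $\mathcal R_k$ of $P_\pi$, with the transient classes ordered so that transitions from $\mathcal T_j$ to $\mathcal T_i$ with $i<j$ have probability zero. Write $v_{\mathcal C}$ and $r_{\mathcal C}$ for the restrictions of $v_\pi$ and $r_\pi$ to a class $\mathcal C$, and $P_{\mathcal C\mathcal C'}$ for the block of $P_\pi$ with rows in $\mathcal C$ and columns in $\mathcal C'$. 1. For each recurrent class $\mathcal R_k$, let $P^{(k)}:=P_{\mathcal R_k\mathcal R_k}$, let $\mu^{(k)}$ be its stationary distribution, and assume $\langle r_{\mathcal R_k}\rangle_{\mu^{(k)}}>0$. Then $$v_{\mathcal R_k}(s)=\frac{\langle r_{\mathcal R_k}\rangle_{\mu^{(k)}}}{1-\gamma}\,\frac{w(s)}{\mu^{(k)}(s)},\qquad s\in\mathcal R_k,$$ where $w$ is the PageRank vector of the time-reversed chain $(P^{(k)})^*$ with teleportation parameter $\gamma$ and restart distribution $u(s)=r_{\mathcal R_k}(s)\mu^{(k)}(s)/\langle r_{\mathcal R_k}\rangle_{\mu^{(k)}}$. 2. For each transient class $\mathcal T_j$, let $Q^{(j)}:=P_{\mathcal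 T_j\mathcal T_j}$, let $\lambda^{(j)}:=\rho(Q^{(j)})$ be its spectral radius, assumed to lie in $(0,1)$, and let $\nu^{(j)}$ be its quasi-stationary distribution, so that $\nu^{(j)}Q^{(j)}=\lambda^{(j)}\nu^{(j)}$. Define $$\tilde r^{(j)}:=r_{\mathcal T_j}+\sum_{k=j+1}^{m}P_{\mathcal T_j\mathcal T_k}v_{\mathcal T_k}+\sum_{k=1}^{\ell}P_{\mathcal T_j\mathcal R_k}v_{\mathcal R_k},$$ and assume $\langle\tilde r^{(j)}\rangle_{\nu^{(j)}}>0$. Then $$v_{\mathcal T_j}(s)=\frac{\langle\tilde r^{(j)}\rangle_{\nu^{(j)}}}{1-\gamma\lambda^{(j)}}\,\frac{w(s)}{\nu^{(j)}(s)},\qquad s\in\mathcal T_j,$$ where $w$ is the PageRank vector of the time-reversed Doob transform $(\widetilde Q^{(j)})^*$ with teleportation parameter $\gamma\lambda^{(j)}$ and restart distribution $u(s)=\tilde r^{(j)}(s)\nu^{(j)}(s)/\langle\tilde r^{(j)}\rangle_{\nu^{(j)}}$.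
   Context: A finite Markov decision process has a finite state space $\mathcal S$, a finite action space $\mathscr A$, transition probabilities $p(s'\mid s,a)$ and rewards $r(s,a)$. A stationary deterministic policy is a map $\pi:\mathcal S\to\mathscr A$; it induces the Markov chain $(X_t)_{t\ge0}$ with transition matrix $P_\pi(s,s')=p(s'\mid s,\pi(s))$ and the reward vector $r_\pi(s)=r(s,\pi(s))$. The value function is $v_\pi(s)=\mathbb E\big[\sum_{t\ge0}\gamma^t r_\pi(X_t)\mid X_0=s\big]$; equivalently, for $\gamma<1$, it is the unique solution of $v_\pi=r_\pi+\gamma P_\pi v_\pi$. Notation: $\langle b\rangle_\nu:=\sum_s b(s)\nu(s)$. The diagonal blocks $P^{(k)}$ are stochastic and irreducible, and the diagonal blocks $Q^{(j)}$ are substochastic and irreducible. Time reversal: for an irreducible stochastic matrix $P$ with (unique, strictly positive) stationary distribution $\mu=\mu P$, put $P^*:=D^{-1}P^\top D$ with $D=\mathrm{diag}(\mu)$. Quasi-stationary distribution and Doob transform: for an irreducible substochastic matrix $Q$ with spectral radius $\lambda=\rho(Q)\in(0,1)$, let $\nu$ be the strictly positive left eigenvector, $\nu Q=\lambda\nu$, normalized to be a probability vector (the quasi-stationary distribution), and $h$ the strictly positive right eigenvector, $Qh=\lambda h$, normalized by $\nu h=1$. With $H=\mathrm{diag}(h)$, the Doob transform is $\widetilde Q:=\frac1\lambda H^{-1}QH$, a stochastic irreducible matrix with stationary distribution $\widetilde\nu(s)=\nu(s)h(s)$. Its time reversal is $\widetilde Q^*:=\widetilde D^{-1}\widetilde Q^\top\widetilde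 D=\frac1\lambda D^{-1}Q^\top D$, where $\widetilde D=\mathrm{diag}(\widetilde\nu)$ and $D=\mathrm{diag}(\nu)$; it is row-stochastic. PageRank: given a row-stochastic matrix $M$, a teleportation parameter $c\in[0,1)$ and a probability vector $u$ (the restart distribution), the PageRank vector is the unique probability row vector $w$ with $w=c\,wM+(1-c)\,u$.
   Formalization: The effective reward of a transient class is taken with a factor γ on the two sums of contributions from later transient classes and recurrent classes; as printed, without γ, part 2 is false (r=1, γ=1/2, stay or be absorbed with probability 1/2: value 2, formula 8/3). *)

(* Defs.v *)
From HB Require Import structures.
From mathcomp Require Import all_boot all_order all_algebra.
From mathcomp Require Import all_classical all_reals all_analysis.
From mathcomp.real_closed Require Import complex.

Set Implicit Arguments.
Unset Strict Implicit.
Unset Printing Implicit Defensive.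

Import Order.TTheory GRing.Theory Num.Theory.

Local Open Scope ring_scope.

Record finMDP (R : realType) (S A : finType) := FinMDP {
  trans : S -> A -> S -> R ;
  reward : S -> A -> R ;
  trans_ge0 : forall s a s', 0 <= trans s a s' ;
  trans_sum1 : forall s a, \sum_(s' : S) trans s a s' = 1 }.

Section Policy.
Context (R : realType) (S A : finType) (M : finMDP R S A) (pi : S -> A).

Definition policy_trans (s s' : S) : R := trans M s (pi s) s'.
Definition policy_reward (s : S) : R := reward M s (pi s).

End Policy.

Section MarkovChain.
Context (R : realType) (S : finType) (P : S -> S -> R).
Context (d : measure_display) (Omega : measurableType d).

(* [Pr s] is the law of the chain [X] started at [s]; [x] enumerates
   trajectories, of which only the first coordinates matter. *)
Record markov_chain (Pr : S -> probability Omega R) (X : nat -> Omega -> S) :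
    Prop := MarkovChain {
  chain_measurable : forall t s, measurable [set w | X t w = s]%classic ;
  chain_start : forall s, Pr s [set w | X 0%N w = s]%classic = 1%E ;
  chain_step : forall s n (x : nat -> S),
    Pr s [set w | forall t, (t <= n.+1)%N -> X t w = x t]%classic =
    (Pr s [set w | forall t, (t <= n)%N -> X t w = x t]%classic
       * (P (x n) (x n.+1))%:E)%E }.

Definition value_function (gamma : R) (r : S -> R)
    (Pr : S -> probability Omega R) (X : nat -> Omega -> S) (s : S) : R :=
  fine ('E_(Pr s)[fun w =>
    limn (fun n => \sum_(0 <= t < n) gamma ^+ t * r (X t w))%R])%E.

Definition recurrent (Pr : S -> probability Omega R) (X : nat -> Omega -> S)
    (s : S) : Prop :=
  Pr s [set w | exists2 t, (0 < t)%N & X t w = s]%classic = 1%E.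

Definition communicates (s s' : S) : bool :=
  connect [rel x y | 0 < P x y] s s' && connect [rel x y | 0 < P x y] s' s.

Definition communicating_class (C : {set S}) : Prop :=
  exists s, C = [set s' | communicates s s'].

Record class_decomposition (Pr : S -> probability Omega R)
    (X : nat -> Omega -> S) (m l : nat)
    (T : 'I_m -> {set S}) (Rc : 'I_l -> {set S}) : Prop := ClassDecomposition {
  transient_class : forall j, communicating_class (T j) /\
    forall s, s \in T j -> ~ recurrent Pr X s ;
  recurrent_class : forall k, communicating_class (Rc k) /\
    forall s, s \in Rc k -> recurrent Pr X s ;
  transient_inj : injective T ;
  recurrent_inj : injective Rc ;
  class_cover : forall s, (exists j, s \in T j) \/ (exists k, s \in Rc k) ;
  transient_order : forall (i j : 'I_m) s s',
    (i < j)%N -> s \in T j -> s' \in T i -> P s s' = 0 }.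

End MarkovChain.

(* Blocks and restrictions are indexed by positions in [enum C]. *)
Section Blocks.
Context (R : realType) (S : finType).

Definition block (P : S -> S -> R) (C D : {set S}) : 'M[R]_(#|C|, #|D|) :=
  \matrix_(i, j) P (enum_val i) (enum_val j).

Definition restriction (b : S -> R) (C : {set S}) : 'cV[R]_#|C| :=
  \col_i b (enum_val i).

End Blocks.

Section Vectors.
Context (R : realType) (n : nat).
Implicit Types (P Q M : 'M[R]_n) (mu nu u w : 'rV[R]_n) (b h : 'cV[R]_n).

Definition wsum b nu : R := \sum_i b i 0 * nu 0 i.

Definition prob_vector w : Prop :=
  (forall i, 0 <= w 0 i) /\ \sum_i w 0 i = 1.

Definition row_stochastic M : Prop :=
  (forall i j, 0 <= M i j) /\ (forall i, \sum_j M i j = 1).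

Definition stationary P mu : Prop := prob_vector mu /\ mu = mu *m P.

Definition time_reversal P mu : 'M[R]_n :=
  invmx (diag_mx mu) *m P^T *m diag_mx mu.

Definition spectral_radius Q : R :=
  sup [set Normc.normc z
      | z in [set z : R[i] | eigenvalue (map_mx (real_complex R) Q) z]]%classic.

Definition quasi_stationary Q nu : Prop :=
  [/\ prob_vector nu, forall i, 0 < nu 0 i & nu *m Q = spectral_radius Q *: nu].

Definition right_eigenvector Q nu h : Prop :=
  [/\ forall i, 0 < h i 0, Q *m h = spectral_radius Q *: h & nu *m h = 1%:M].

Definition doob Q h : 'M[R]_n :=
  (spectral_radius Q)^-1 *: (invmx (diag_mx h^T) *m Q *m diag_mx h^T).

Definition doob_stationary nu h : 'rV[R]_n := \row_i (nu 0 i * h i 0).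

Definition restart b nu : 'rV[R]_n := \row_i (b i 0 * nu 0 i / wsum b nu).

Definition pagerank_eq M (c : R) u w : Prop :=
  prob_vector w /\ w = c *: (w *m M) + (1 - c) *: u.

Record pagerank M (c : R) u w : Prop := PageRank {
  pagerank_matrix : row_stochastic M ;
  pagerank_teleport : 0 <= c < 1 ;
  pagerank_restart : prob_vector u ;
  pagerank_unique : unique (pagerank_eq M c u) w }.

End Vectors.

(* The factor [gamma] discounts the step on which the class is left: the Bellman
   equation v = r + gamma P v, restricted to [T j], reads
   v_T = effective_reward + gamma Q v_T.  Without it the formula for transient
   classes fails: if r = 1 everywhere, gamma = 1/2 and a transient state stays
   put or moves to an absorbing state with probability 1/2 each, then its value
   is 2, not 8/3. *)
Definition effective_reward (R : realType) (S : finType) (P : S -> S -> R)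
    (gamma : R) (r v : S -> R) (m l : nat)
    (T : 'I_m -> {set S}) (Rc : 'I_l -> {set S}) (j : 'I_m) : 'cV[R]_#|T j| :=
  restriction r (T j)
  + gamma *: (\sum_(k < m | (j < k)%N)
                block P (T j) (T k) *m restriction v (T k)
              + \sum_(k < l) block P (T j) (Rc k) *m restriction v (Rc k)).

(* Main.v *)
Require Import Defs.
From HB Require Import structures.
From mathcomp Require Import all_boot all_order all_algebra.
From mathcomp Require Import ring.
From mathcomp Require Import all_classical all_reals all_analysis.
From mathcomp Require Import measurable_realfun.

Set Implicit Arguments.
Unset Strict Implicit.
Unset Printing Implicit Defensive.

Import Order.TTheory GRing.Theory Num.Theory.
Import numFieldNormedType.Exports.
Local Open Scope ring_scope.

(** The two formulas are one computation.  Let Q be a nonnegative matrix with a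
strictly positive left eigenvector nu, nu Q = lambda nu, and let v solve
v = b + gamma Q v with b, v >= 0.  Pairing with nu gives
<v>_nu = <b>_nu / (1 - gamma lambda), so the row vector v(s) nu(s) / <v>_nu is a
probability vector.  Multiplying the equation for v at s by nu(s) turns it into
the PageRank equation of the matrix M = lambda^-1 D^-1 Q^T D, D = diag(nu), with
teleportation gamma lambda and restart b nu / <b>_nu.  This M is row-stochastic
because nu is an eigenvector, so w |-> (gamma lambda) w M contracts the l1 norm
and the PageRank vector is unique ([pagerank_of_bellman]).  On a recurrent class
lambda = 1 and M is the time reversal itself; on a transient class the
eigenvector h of the Doob transform cancels from its time reversal, which leaves
the same M ([time_reversal_doobE]).

What has to be proved about the chain is that the restriction of the value
function to a class solves such an equation.  The expected reward at time t is
P^t r, by the one-step Markov property, and monotone convergence exchanges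
expectation and discounted sum, so the value is the series of gamma^t P^t r; this
gives the Bellman equation v = r + gamma P v on the whole state space
([bellman]).  Splitting the sum over states according to classes yields the
equation on a transient class, with the contribution of the later classes
absorbed in the effective reward ([transient_bellman]).  A recurrent class is
closed: leaving to a state from which there is no way back would make the return
probability less than one ([recurrent_closed]).  Hence the Bellman equation
restricts to it without any extra term ([closed_bellman]), and a stationary
distribution on it is strictly positive because its positivity spreads along
transitions ([stationary_gt0]). *)

(** * PageRank vectors of time-reversed matrices *)

Lemma invmx_diag (R : fieldType) (n : nat) (d : 'rV[R]_n) :
  (forall i, d 0 i != 0) -> invmx (diag_mx d) = diag_mx (\row_i (d 0 i)^-1).
Proof.
move=> d_neq0.
have dV : diag_mx d *m diag_mx (\row_i (d 0 i)^-1) = 1%:M.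
  by apply/matrixP => i j; rewrite mul_diag_mx !mxE mulrnAr mulfV.
have [d_unit _] := mulmx1_unit dV.
by rewrite -[LHS]mulmx1 -dV mulKmx.
Qed.

Lemma time_reversalE (R : realType) (n : nat) (P : 'M[R]_n) (mu : 'rV[R]_n) i j :
  (forall i, 0 < mu 0 i) ->
  time_reversal P mu i j = (mu 0 i)^-1 * P j i * mu 0 j.
Proof.
move=> mu_gt0; rewrite /time_reversal invmx_diag => [|k]; last by rewrite gt_eqF.
by rewrite mul_mx_diag mul_diag_mx !mxE.
Qed.

(** The eigenvector h enters the Doob transform and its stationary distribution
in such a way that it cancels here: only nu and the eigenvalue remain. *)
Lemma time_reversal_doobE (R : realType) (n : nat) (Q : 'M[R]_n)
    (nu : 'rV[R]_n) (h : 'cV[R]_n) i j :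
  (forall i, 0 < nu 0 i) -> (forall i, 0 < h i 0) -> spectral_radius Q != 0 ->
  time_reversal (doob Q h) (doob_stationary nu h) i j =
    (spectral_radius Q)^-1 * (nu 0 i)^-1 * Q j i * nu 0 j.
Proof.
move=> nu_gt0 h_gt0 lambda_neq0; rewrite time_reversalE => [|k]; last first.
  by rewrite mxE mulr_gt0.
rewrite /doob invmx_diag => [|k]; last by rewrite mxE gt_eqF.
rewrite mul_mx_diag mul_diag_mx !mxE.
by field; rewrite lambda_neq0 !gt_eqF.
Qed.

(** The difference e of two solutions satisfies e = c e M, hence
|e|_1 <= c |e|_1 since M is row-stochastic, and c < 1 forces e = 0. *)
Lemma pagerank_eq_uniq (R : realType) (n : nat) (M : 'M[R]_n) (c : R)
    (u w w' : 'rV[R]_n) :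
  row_stochastic M -> 0 <= c < 1 ->
  w = c *: (w *m M) + (1 - c) *: u ->
  w' = c *: (w' *m M) + (1 - c) *: u -> w = w'.
Proof.
move=> [M_ge0 M_sum1] /andP[c_ge0 c_lt1] w_eq w'_eq.
set e := w - w'.
have e_eq : e = c *: (e *m M).
  by rewrite /e {1}w_eq {1}w'_eq mulmxBl scalerBr opprD addrACA subrr addr0.
have norm_le : \sum_j `|e 0 j| <= c * \sum_i `|e 0 i|.
  rewrite {1}e_eq.
  apply: (@le_trans _ _ (\sum_j c * \sum_i `|e 0 i| * M i j)).
    apply: ler_sum => j _; rewrite !mxE normrM (ger0_norm c_ge0) ler_wpM2l//.
    apply: le_trans (ler_norm_sum _ _ _) _; apply: ler_sum => i _.
    by rewrite normrM (ger0_norm (M_ge0 i j)).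
  rewrite -mulr_sumr exchange_big/=; under eq_bigr do rewrite -mulr_sumr M_sum1 mulr1.
  exact: lexx.
have norm_ge0 : 0 <= \sum_j `|e 0 j| by apply: sumr_ge0.
have norm0 : \sum_j `|e 0 j| = 0.
  apply/eqP; rewrite eq_le norm_ge0 andbT -(pmulr_rle0 _ (x := 1 - c)) ?subr_gt0//.
  by rewrite mulrBl mul1r subr_le0.
apply/eqP; rewrite -subr_eq0; apply/eqP/rowP => j; rewrite [RHS]mxE -/e.
by apply/eqP; rewrite -normr_eq0; apply/eqP/(psumr_eq0P _ norm0).
Qed.

(** The form of M covers both the time reversal of a stochastic matrix, with
lambda = 1, and the time reversal of a Doob transform. *)
Lemma pagerank_of_bellman (R : realType) (n : nat) (Q M : 'M[R]_n) (gamma lambda : R)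
    (nu : 'rV[R]_n) (b v : 'cV[R]_n) :
  (forall i j, 0 <= Q i j) -> (forall i, 0 < nu 0 i) ->
  nu *m Q = lambda *: nu -> 0 < lambda -> 0 <= gamma * lambda < 1 ->
  (forall i j, M i j = lambda^-1 * (nu 0 i)^-1 * Q j i * nu 0 j) ->
  (forall i, 0 <= b i 0) -> (forall i, 0 <= v i 0) ->
  v = b + gamma *: (Q *m v) -> 0 < wsum b nu ->
  exists w, pagerank M (gamma * lambda) (restart b nu) w /\
    forall i, v i 0 = wsum b nu / (1 - gamma * lambda) * (w 0 i / nu 0 i).
Proof.
move=> Q_ge0 nu_gt0 nuQ lambda_gt0 c_range ME b_ge0 v_ge0 v_eq b_gt0.
have nu_neq0 i : nu 0 i != 0 by rewrite gt_eqF.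
have lambda_neq0 : lambda != 0 by rewrite gt_eqF.
have b_neq0 : wsum b nu != 0 by rewrite gt_eqF.
have /andP[_ c_lt1] := c_range.
have c_gt0 : 0 < 1 - gamma * lambda by rewrite subr_gt0.
have c_neq0 : 1 - gamma * lambda != 0 by rewrite gt_eqF.
have M_stoch : row_stochastic M.
  split=> [i j|i].
    by rewrite ME !mulr_ge0// ?invr_ge0 ?(ltW lambda_gt0)// ltW.
  under eq_bigr do rewrite ME -!mulrA.
  rewrite -mulr_sumr -mulr_sumr.
  under eq_bigr do rewrite mulrC.
  have /rowP/(_ i) := nuQ; rewrite !mxE => ->.
  by rewrite mulrCA mulKf// mulVf.
(* Pair the equation for v with the left eigenvector nu. *)
have wsum_v : wsum v nu = wsum b nu / (1 - gamma * lambda).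
  have wsumE (x : 'cV[R]_n) : wsum x nu = (nu *m x) 0 0.
    by rewrite mxE; apply: eq_bigr => i _; rewrite mulrC.
  apply: (canRL (mulfK c_neq0)).
  have : nu *m v = nu *m b + (gamma * lambda) *: (nu *m v).
    rewrite {1}v_eq mulmxDr -scalemxAr mulmxA nuQ -scalemxAl scalerA //.
  move/matrixP/(_ 0 0); rewrite !wsumE !mxE => e.
  by rewrite mulrBr mulr1 {1}e mulrC addrK.
pose w : 'rV[R]_n := \row_i (v i 0 * nu 0 i / wsum v nu).
have v_gt0 : 0 < wsum v nu by rewrite wsum_v divr_gt0.
have prob_restart (x : 'cV[R]_n) : (forall i, 0 <= x i 0) -> 0 < wsum x nu ->
    prob_vector (restart x nu).
  move=> x_ge0 x_gt0; split=> [i|].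
    by rewrite mxE !mulr_ge0// ?invr_ge0 ltW.
  by under eq_bigr do rewrite mxE; rewrite -mulr_suml divff// gt_eqF.
have w_eq : w = (gamma * lambda) *: (w *m M) + (1 - gamma * lambda) *: restart b nu.
  apply/rowP => j; rewrite !mxE.
  have vj : v j 0 = b j 0 + gamma * \sum_k Q j k * v k 0.
    by have /matrixP/(_ j 0) := v_eq; rewrite !mxE.
  have -> : \sum_i w 0 i * M i j =
      lambda^-1 * (nu 0 j / wsum v nu) * \sum_k Q j k * v k 0.
    rewrite mulr_sumr; apply: eq_bigr => i _; rewrite ME mxE.
    by field; rewrite gt_eqF// lambda_neq0 nu_neq0.
  rewrite vj wsum_v.
  by field; rewrite b_neq0 c_neq0.
exists w; split; last first.
  move=> i; rewrite mxE -wsum_v.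
  by field; rewrite nu_neq0 gt_eqF.
split=> //; first exact: prob_restart.
split; first by split=> //; exact: (prob_restart v).
by move=> w' [_ w'_eq]; apply: pagerank_eq_uniq w_eq w'_eq.
Qed.

(** * The law of the Markov chain *)

Section MarkovChainLaw.
Context (R : realType) (S : finType) (P : S -> S -> R).
Context (d : measure_display) (Omega : measurableType d).
Context (Pr : S -> probability Omega R) (X : nat -> Omega -> S).
Hypothesis chain : markov_chain P Pr X.
Local Open Scope classical_set_scope.

Lemma measurable_trajectory (k n : nat) (x : nat -> S) :
  measurable [set w | forall t, (k <= t <= n)%N -> X t w = x t].
Proof.
rewrite [X in measurable X](_ : _ =
    \bigcap_(t in [set t | (k <= t <= n)%N]) [set w | X t w = x t]) //.
by apply: bigcap_measurableType => t _; exact: (chain_measurable chain).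
Qed.

Lemma measure_by_coordinate (s : S) (t : nat) (E : set Omega) :
  measurable E -> (Pr s E = \sum_(z : S) Pr s (E `&` [set w | X t w = z]))%E.
Proof.
move=> mE.
have := @measure_fin_bigcup _ _ _ (Pr s) S setT (fun z => E `&` [set w | X t w = z]).
rewrite -setI_bigcupr (_ : \bigcup_z _ = setT) ?setIT; last first.
  by apply/seteqP; split=> // w _; exists (X t w).
move=> ->.
- rewrite fsbig_finite//=; apply: perm_big; apply: uniq_perm.
  - exact: finmap.fset_uniq.
  - exact: index_enum_uniq.
  - move=> z; rewrite mem_index_enum in_fset_set; last exact: finite_finset.
    exact: in_setT.
- exact: finite_finset.
- by move=> z z' _ _ [w [[_ <-] [_ <-]]].
- by move=> z _; apply: measurableI => //; exact: (chain_measurable chain).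
Qed.

(** The defining property of the chain prescribes all coordinates from time 0 on.
Summing over the value of the first prescribed coordinate removes it, so the
step formula survives when only the coordinates from time k on are fixed. *)
Lemma trajectory_step (s : S) (n k : nat) (x : nat -> S) : (k <= n)%N ->
  (Pr s [set w | forall t, (k <= t <= n.+1)%N -> X t w = x t] =
   Pr s [set w | forall t, (k <= t <= n)%N -> X t w = x t]
     * (P (x n) (x n.+1))%:E)%E.
Proof.
elim: k x => [|k IHk] x k_le; first exact: (chain_step chain).
(* Prescribing also the value z at time k overrides x at k only; the last two
   coordinates n and n.+1, which enter the step probability, are not k. *)
have fix_coordinate N (z : S) : (k < N)%N ->
    [set w | forall t, (k < t <= N)%N -> X t w = x t] `&` [set w | X k w = z] =
    [set w | forall t, (k <= t <= N)%N ->
               X t w = (if t == k then z else x t)].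
  move=> k_lt; apply/seteqP; split=> w /=.
    move=> [wx wz] t /andP[k_le_t t_le]; case: eqP => [-> //|/eqP t_neq].
    by apply: wx; rewrite t_le andbT ltn_neqAle eq_sym t_neq.
  move=> wx; split=> [t /andP[k_lt_t t_le]|].
    by have := wx t; rewrite (ltnW k_lt_t) t_le gtn_eqF//; apply.
  by have := wx k; rewrite eqxx leqnn ltnW//; apply.
rewrite (@measure_by_coordinate _ k)//; last exact: measurable_trajectory.
rewrite [in RHS](@measure_by_coordinate _ k)//; last exact: measurable_trajectory.
rewrite ge0_sume_distrl//; apply: eq_bigr => z _.
rewrite !fix_coordinate// ?(leqW k_le)//.
have -> := IHk (fun t => if t == k then z else x t) (ltnW k_le).
by rewrite !gtn_eqF// ltnW.
Qed.

Lemma markov_step (s x y : S) (n : nat) :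
  (Pr s [set w | X n w = x /\ X n.+1 w = y] =
   Pr s [set w | X n w = x] * (P x y)%:E)%E.
Proof.
have := @trajectory_step s n n (fun t => if t == n then x else y) (leqnn n).
rewrite eqxx gtn_eqF//.
rewrite [X in Pr s X = _ -> _](_ : _ = [set w | X n w = x /\ X n.+1 w = y]).
  rewrite [X in _ = (Pr s X * _)%E -> _](_ : _ = [set w | X n w = x])//.
  apply/seteqP; split=> w /=; first by move=> /(_ n); rewrite leqnn eqxx; apply.
  by move=> wx t; rewrite -eqn_leq => /eqP <-; rewrite eqxx.
apply/seteqP; split=> w /=.
  move=> wx; split; first by have := wx n; rewrite leqnn leqnSn eqxx; apply.
  by have := wx n.+1; rewrite leqnn leqnSn gtn_eqF//; apply.
move=> [wx wy] t /andP[n_le t_le]; case: eqP => [->//|/eqP t_neq].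
suff -> : t = n.+1 by [].
by apply/eqP; rewrite eqn_leq t_le ltn_neqAle eq_sym t_neq.
Qed.

Definition law_at (t : nat) (s y : S) : R := fine (Pr s [set w | X t w = y]).

Lemma law_atE t s y : Pr s [set w | X t w = y] = (law_at t s y)%:E.
Proof. by rewrite fineK// fin_num_measure//; exact: (chain_measurable chain). Qed.

Lemma law_at0 s y : law_at 0 s y = (s == y)%:R.
Proof.
rewrite /law_at; have [<-|s_neq_y] := eqVneq; first by rewrite (chain_start chain).
suff -> : Pr s [set w | X 0%N w = y] = 0%E by [].
apply/eqP; rewrite -measure_le0.
have mX z : measurable [set w | X 0%N w = z] by exact: (chain_measurable chain).
apply: (@le_trans _ _ (Pr s (~` [set w | X 0%N w = s]))).
  apply: le_measure; rewrite ?inE//; first exact: measurableC.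
  by move=> w /= -> /eqP; rewrite eq_sym (negbTE s_neq_y).
by rewrite probability_setC// (chain_start chain) subee.
Qed.

Lemma law_atS t s y : law_at t.+1 s y = \sum_x law_at t s x * P x y.
Proof.
apply/EFin_inj; rewrite -law_atE (@measure_by_coordinate _ t); last first.
  exact: (chain_measurable chain).
rewrite -sumEFin; apply: eq_bigr => x _.
by rewrite setIC markov_step law_atE EFinM.
Qed.

Definition transition_op (f : S -> R) (s : S) : R := \sum_y P s y * f y.

(** By induction on t with f generalized, because the last step is the one that
[law_atS] exposes: it replaces f by its image under the transition operator. *)
Lemma law_at_iter t s (f : S -> R) :
  \sum_y law_at t s y * f y = iter t transition_op f s.
Proof.
elim: t f => [|t IHt] f.
  rewrite (bigD1 s)//= law_at0 eqxx mul1r big1 ?addr0// => y y_neq.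
  by rewrite law_at0 eq_sym (negbTE y_neq) mul0r.
rewrite iterSr -IHt; under eq_bigr do rewrite law_atS mulr_suml.
rewrite exchange_big/=; apply: eq_bigr => x _.
by rewrite mulr_sumr; apply: eq_bigr => y _; rewrite mulrA.
Qed.

Lemma iter_transitionZ t a f s :
  iter t transition_op (fun y => a * f y) s = a * iter t transition_op f s.
Proof.
elim: t s => [//|t IHt] s /=; rewrite /transition_op mulr_sumr.
by apply: eq_bigr => y _; rewrite IHt mulrCA.
Qed.

Lemma measurable_reward (t : nat) (f : S -> R) :
  measurable_fun setT (fun w => (f (X t w))%:E).
Proof.
move=> _ Y mY; rewrite setTI.
rewrite (_ : _ @^-1` Y = \bigcup_(z in [set z | Y (f z)%:E]) [set w | X t w = z]).
  apply: fin_bigcup_measurable => [|z _]; first exact: finite_finset.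
  exact: (chain_measurable chain).
by apply/seteqP; split=> [w Yw|w [z Yz /= wz]]; [exists (X t w) | rewrite /= wz].
Qed.

Lemma integral_reward (t : nat) (s : S) (f : S -> R) : (forall y, 0 <= f y) ->
  (\int[Pr s]_w (f (X t w))%:E = (iter t transition_op f s)%:E)%E.
Proof.
move=> f_ge0; have mX y : measurable [set w | X t w = y].
  exact: (chain_measurable chain).
have indicE w : ((f (X t w))%:E =
    \sum_y (f y)%:E * (\1_[set w | X t w = y] w)%:E)%E.
  rewrite (bigD1 (X t w))//= big1 ?adde0.
    by rewrite indicE mem_set// mule1.
  move=> y y_neq; rewrite indicE memNset ?mule0//= => wy.
  by rewrite wy eqxx in y_neq.
have m_indic y : measurable_fun setT
    (fun w => (\1_[set w | X t w = y] w : R)%:E).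
  by apply/measurable_EFinP; exact: measurable_indic.
under eq_integral do rewrite indicE.
rewrite ge0_integral_sum//; last 2 first.
- by move=> y; apply: measurable_funeM.
- by move=> y w _; rewrite mule_ge0// lee_fin.
rewrite -law_at_iter -sumEFin; apply: eq_bigr => y _.
rewrite ge0_integralZl_EFin//.
rewrite integral_indic// setIT muleC.
transitivity (Pr s [set w | X t w = y] * (f y)%:E)%E; first by [].
by rewrite law_atE EFinM.
Qed.

(** * The Bellman equation *)

Section Discounted.
Variables (gamma : R) (r : S -> R).
Hypothesis gamma_range : 0 <= gamma < 1.
Hypothesis r_ge0 : forall s, 0 <= r s.
Hypothesis P_ge0 : forall s s', 0 <= P s s'.
Hypothesis P_sum1 : forall s, \sum_s' P s s' = 1.
(* Any common bound of the rewards would do; the sum needs no maximum. *)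
Let rmax := \sum_s r s.

Lemma iter_transition_bound t s : 0 <= iter t transition_op r s <= rmax.
Proof.
elim: t s => [|t IHt] s /=.
  by rewrite r_ge0/= /rmax (bigD1 s)//= lerDl sumr_ge0.
apply/andP; split.
  by apply: sumr_ge0 => y _; rewrite mulr_ge0//; case/andP: (IHt y).
rewrite -[rmax]mul1r -(P_sum1 s) mulr_suml; apply: ler_sum => y _.
by rewrite ler_wpM2l//; case/andP: (IHt y).
Qed.

Lemma is_cvg_discounted (u : nat -> R) : (forall t, 0 <= u t <= rmax) ->
  cvgn (series (fun t => gamma ^+ t * u t)).
Proof.
move=> u_bound; have /andP[gamma_ge0 gamma_lt1] := gamma_range.
apply: (@series_le_cvg _ _ (geometric rmax gamma)).
- by move=> t; rewrite mulr_ge0 ?exprn_ge0//; case/andP: (u_bound t).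
- move=> t; rewrite /geometric/= mulr_ge0 ?exprn_ge0//.
  by apply: sumr_ge0 => y _.
- move=> t; rewrite /geometric/= mulrC ler_wpM2r ?exprn_ge0//.
  by case/andP: (u_bound t).
- by apply: is_cvg_geometric_series; rewrite ger0_norm.
Qed.

(** Monotone convergence: the discounted rewards are nonnegative.  The real limits
inside and outside the expectation are limits in the extended reals because
both series are dominated by a geometric one. *)
Lemma value_functionE s : value_function gamma r Pr X s =
  limn (series (fun t => gamma ^+ t * iter t transition_op r s)).
Proof.
have /andP[gamma_ge0 _] := gamma_range.
rewrite /value_function expectation.unlock.
have -> : (\int[Pr s]_w (limn (series (fun t => gamma ^+ t * r (X t w))%R))%:E =
    \int[Pr s]_w \sum_(0 <= t <oo) (gamma ^+ t * r (X t w))%:E)%E.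
  apply: eq_integral => w _; rewrite -EFin_lim; last first.
    apply: (@is_cvg_discounted (fun t => r (X t w))) => t.
    by rewrite r_ge0/= /rmax (bigD1 (X t w))//= lerDl sumr_ge0.
  congr (limn _); apply/funext => n /=.
  by rewrite /series/= -sumEFin.
have discount_ge0 t y : 0 <= gamma ^+ t * r y by rewrite mulr_ge0 ?exprn_ge0.
rewrite integral_nneseries//; last 2 first.
- by move=> t; exact: (measurable_reward t (fun y => gamma ^+ t * r y)%R).
- by move=> t w _; rewrite lee_fin.
have -> : (\sum_(0 <= t <oo) \int[Pr s]_w (gamma ^+ t * r (X t w))%:E =
    limn (EFin \o series (fun t => gamma ^+ t * iter t transition_op r s)%R))%E.
  congr (limn _); apply/funext => n /=; rewrite /series/= -sumEFin.
  apply: eq_bigr => t _; rewrite (@integral_reward t s (fun y => (gamma ^+ t * r y)%R))//.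
  by rewrite iter_transitionZ.
by rewrite EFin_lim//; apply: is_cvg_discounted => t; exact: iter_transition_bound.
Qed.

Lemma cvg_value_function s :
  series (fun t => gamma ^+ t * iter t transition_op r s) @ \oo -->
  value_function gamma r Pr X s.
Proof.
rewrite value_functionE; apply: is_cvg_discounted => t.
exact: iter_transition_bound.
Qed.

(** The partial sums satisfy the equation with n.+1 on the left and n on the right;
pass to the limit on both sides. *)
Lemma bellman s : value_function gamma r Pr X s =
  r s + gamma * \sum_y P s y * value_function gamma r Pr X y.
Proof.
pose partial n x := series (fun t => gamma ^+ t * iter t transition_op r x) n.
have partialS n : partial n.+1 s = r s + gamma * \sum_y P s y * partial n y.
  rewrite /partial /series/= big_nat_recl//= expr0 mul1r; congr (_ + _).
  under [in RHS]eq_bigr do rewrite mulr_sumr.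
  rewrite exchange_big mulr_sumr; apply: eq_bigr => t _.
  rewrite exprS -mulrA; congr (_ * _); rewrite mulr_sumr.
  by apply: eq_bigr => y _; rewrite mulrCA.
have shifted : (fun n => partial n.+1 s) @ \oo --> value_function gamma r Pr X s.
  by rewrite (cvg_shiftS (fun n => partial n s)); exact: cvg_value_function.
apply: (cvg_unique _ shifted) => //.
rewrite (_ : (fun _ => _) = fun n => r s + gamma * \sum_y P s y * partial n y).
  apply: cvgD; first exact: cvg_cst.
  apply: cvgMl_tmp; apply: cvg_big => [|y _]; first exact: add_continuous.
  by apply: cvgMl_tmp; exact: cvg_value_function.
by apply/funext.
Qed.

Lemma value_function_ge0 s : 0 <= value_function gamma r Pr X s.
Proof.
have /andP[gamma_ge0 _] := gamma_range.
rewrite value_functionE; apply: limr_ge.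
  by apply: is_cvg_discounted => t; exact: iter_transition_bound.
apply: nearW => n; apply: sumr_ge0 => t _.
by rewrite mulr_ge0 ?exprn_ge0//; case/andP: (iter_transition_bound t s).
Qed.

End Discounted.

(** * Recurrent classes are closed *)

(** If s could not be reached from y, then a chain that goes from s to y at time 1
would almost surely stay among the states reachable from y and never return to
s; since that step has probability P s y, the chain could return to s only with
probability at most 1 - P s y. *)
Lemma recurrent_closed (s y : S) :
  recurrent Pr X s -> 0 < P s y -> connect [rel x y | 0 < P x y] y s.
Proof.
move=> s_rec Psy; apply: contrapT => /negP y_s.
pose B z := connect [rel x y | 0 < P x y] y z.
have mX t z : measurable [set w | X t w = z] by exact: (chain_measurable chain).
have PnB x z : B x -> ~~ B z -> P x z <= 0.
  move=> Bx; apply: contraNT; rewrite -ltNge => Pxz.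
  by apply: connect_trans Bx _; exact: connect1.
(* Induction on t: the state x at time t either lies in B, and then P x z = 0, or
   does not, and then the induction hypothesis applies to x. *)
have avoid t z : (0 < t)%N -> ~~ B z ->
    Pr s ([set w | X 1%N w = y] `&` [set w | X t w = z]) = 0%E.
  elim: t z => // t IHt z _ Bz.
  have [t0|t_gt0] := posnP t.
    rewrite t0 (_ : _ `&` _ = set0) ?measure0//.
    apply/seteqP; split=> w //= [-> yz].
    by move: Bz; rewrite -yz /B connect0.
  have mE u z' : measurable ([set w | X 1%N w = y] `&` [set w | X u w = z']).
    exact: measurableI.
  rewrite (@measure_by_coordinate _ t)// big1// => x _.
  apply/eqP; rewrite -measure_le0.
  have [Bx|Bx] := boolP (B x); last first.
    rewrite -(IHt x)//; apply: le_measure; rewrite ?inE//.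
      exact: measurableI.
    by move=> w [[? _] ?].
  apply: (@le_trans _ _ (Pr s [set w | X t w = x /\ X t.+1 w = z])).
    apply: le_measure; rewrite ?inE//; first exact: measurableI.
      exact: (measurableI _ _ (mX t x) (mX t.+1 z)).
    by move=> w [[_ ?] ?].
  rewrite markov_step; apply: mule_ge0_le0 => //.
  by rewrite lee_fin PnB.
have mret : measurable [set w | exists2 t, (0 < t)%N & X t w = s].
  rewrite (_ : [set _ | _] = \bigcup_(t in [set t | (0 < t)%N]) [set w | X t w = s]).
    exact: bigcup_measurable.
  by apply/seteqP; split=> w [t ? ?]; exists t.
have y_no_return :
    Pr s ([set w | X 1%N w = y] `&` [set w | exists2 t, (0 < t)%N & X t w = s]) = 0%E.
  apply: measure_negligible; first exact: measurableI.
  apply: (@negligibleS _ _ _ _ (\bigcup_t ([set w | X 1%N w = y] `&` [set w | X t.+1 w = s]))).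
    by move=> w [wy [[//|t] _ wt]]; exists t.
  apply: negligible_bigcup => t; exists ([set w | X 1%N w = y] `&` [set w | X t.+1 w = s]).
  by split=> //; [exact: measurableI | exact: avoid].
have X1y : Pr s [set w | X 1%N w = y] = (P s y)%:E.
  rewrite law_atE law_atS (bigD1 s)//= law_at0 eqxx mul1r big1 ?addr0// => z zs.
  by rewrite law_at0 eq_sym (negbTE zs) mul0r.
have : (Pr s (~` [set w | exists2 t, (0 < t)%N & X t w = s]) = 0)%E.
  by rewrite probability_setC// s_rec subee.
move=> no_return0.
have union0 : Pr s ([set w | X 1%N w = y] `&`
    [set w | exists2 t, (0 < t)%N & X t w = s] `|`
    ~` [set w | exists2 t, (0 < t)%N & X t w = s]) = 0%E.
  by rewrite measureU0//; [exact: measurableI | exact: measurableC].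
move: Psy; rewrite -lte_fin -X1y ltNge => /negP; apply.
rewrite -[X in (_ <= X)%E]union0; apply: le_measure; rewrite ?inE//.
  by apply: measurableU; [exact: measurableI | exact: measurableC].
move=> w /= wy.
by have [ret|] := pselect (exists2 t, (0 < t)%N & X t w = s); [left|right].
Qed.

End MarkovChainLaw.

(** * Communicating classes *)

Lemma block_mulE (R : realType) (S : finType) (P : S -> S -> R) (v : S -> R)
    (C D : {set S}) i :
  (block P C D *m restriction v D) i 0 = \sum_(y in D) P (enum_val i) y * v y.
Proof.
rewrite mxE [RHS]big_enum_val; apply: eq_bigr => j _.
by rewrite !mxE.
Qed.

Lemma communicating_class_connect (R : realType) (S : finType) (P : S -> S -> R)
    (C : {set S}) x y :
  communicating_class P C -> x \in C -> (y \in C) = communicates P x y.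
Proof.
move=> [s ->]; rewrite !inE /communicates => /andP[s_x x_s].
apply/andP/andP=> -[a_y y_a]; split.
- exact: connect_trans x_s a_y.
- exact: connect_trans y_a s_x.
- exact: connect_trans s_x a_y.
- exact: connect_trans y_a x_s.
Qed.

Lemma communicating_class_eq (R : realType) (S : finType) (P : S -> S -> R)
    (C D : {set S}) x :
  communicating_class P C -> communicating_class P D ->
  x \in C -> x \in D -> C = D.
Proof.
move=> classC classD xC xD; apply/setP => y.
by rewrite (communicating_class_connect y classC xC) (communicating_class_connect y classD xD).
Qed.

(** Some entry of mu is positive, and mu = mu P carries positivity from a state
of the class to each of its successors.  That C is closed ensures that a path
between two states of C does not leave C. *)
Lemma stationary_gt0 (R : realType) (S : finType) (P : S -> S -> R)
    (C : {set S}) (mu : 'rV[R]_#|C|) :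
  (forall x y, 0 <= P x y) -> communicating_class P C ->
  (forall x y, x \in C -> 0 < P x y -> y \in C) ->
  stationary (block P C C) mu -> forall i, 0 < mu 0 i.
Proof.
move=> P_ge0 classC C_closed [[mu_ge0 mu_sum1] muP] i.
have [i0 mu_i0] : exists i0, 0 < mu 0 i0.
  apply/existsP; apply: contraT; rewrite negb_exists => /forallP mu_npos.
  suff /eqP : \sum_i mu 0 i = 0 by rewrite mu_sum1 oner_eq0.
  rewrite big1// => j _; apply/eqP; rewrite eq_le mu_ge0 andbT leNgt.
  exact: mu_npos.
have : connect [rel x y | 0 < P x y] (enum_val i0) (enum_val i).
  have := communicating_class_connect (enum_val i) classC (enum_valP i0).
  by rewrite enum_valP => /esym/andP[].
move=> /connectP[p]; elim: p i0 mu_i0 => [|y p IHp] i0 mu_i0 /=.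
  by move=> _ /enum_val_inj ->.
move=> /andP[Piy p_path] p_last.
have yC : y \in C := C_closed _ _ (enum_valP i0) Piy.
move: Piy p_path p_last; rewrite -(enum_rankK_in yC yC) => Piy.
apply: IHp; rewrite muP mxE.
apply: (@lt_le_trans _ _ (mu 0 i0 * block P C C i0 (enum_rank_in yC y))).
  by rewrite mxE mulr_gt0.
rewrite (bigD1 i0)//= lerDl; apply: sumr_ge0 => k _.
by rewrite mxE mulr_ge0.
Qed.

(** * The value function on classes *)

Lemma closed_bellman (R : realType) (S : finType) (P : S -> S -> R)
    (gamma : R) (r v : S -> R) (C : {set S}) :
  (forall x y, 0 <= P x y) ->
  (forall x y, x \in C -> 0 < P x y -> y \in C) ->
  (forall s, v s = r s + gamma * \sum_y P s y * v y) ->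
  restriction v C = restriction r C + gamma *: (block P C C *m restriction v C).
Proof.
move=> P_ge0 C_closed v_eq; apply/colP => i.
rewrite 4!mxE block_mulE v_eq; congr (_ + _ * _).
rewrite [RHS]big_mkcond; apply: eq_bigr => y _; case: ifPn => // yC.
suff -> : P (enum_val i) y = 0 by rewrite mul0r.
apply/eqP; rewrite eq_le P_ge0 andbT leNgt.
by apply: contra yC; apply: C_closed; exact: enum_valP.
Qed.

Section ClassDecomposition.
Context (R : realType) (S : finType) (P : S -> S -> R).
Context (d : measure_display) (Omega : measurableType d).
Context (Pr : S -> probability Omega R) (X : nat -> Omega -> S).
Context (m l : nat) (T : 'I_m -> {set S}) (Rc : 'I_l -> {set S}).
Hypothesis classes : class_decomposition P Pr X T Rc.

(** Distinct communicating classes are disjoint, and no state is both transient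
and recurrent, so every state is counted exactly once on the right. *)
Lemma sum_over_classes (f : S -> R) :
  \sum_y f y = \sum_k \sum_(y in T k) f y + \sum_k \sum_(y in Rc k) f y.
Proof.
have T_class j : communicating_class P (T j) by case: (transient_class classes j).
have Rc_class k : communicating_class P (Rc k) by case: (recurrent_class classes k).
have disjoint y j k : y \in T j -> y \in Rc k -> False.
  move=> yT yR; have [_ /(_ _ yT)] := transient_class classes j; apply.
  by have [_ /(_ _ yR)] := recurrent_class classes k.
rewrite (exchange_big_dep predT)//= [X in _ = _ + X](exchange_big_dep predT)//=.
rewrite -big_split/=; apply: eq_bigr => y _.
have [[j yT]|[k yR]] := class_cover classes y.
  rewrite (big_pred1 j) => [|i]; last first.
    apply/idP/eqP => [yTi|->//]; apply: (transient_inj classes).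
    exact: communicating_class_eq yTi yT.
  by rewrite big_pred0 ?addr0// => k; apply/negP => /(disjoint _ _ _ yT).
rewrite [X in _ + X](big_pred1 k) => [|i]; last first.
  apply/idP/eqP => [yRi|->//]; apply: (recurrent_inj classes).
  exact: communicating_class_eq yRi yR.
by rewrite big_pred0 ?add0r// => j; apply/negP => /disjoint/(_ yR).
Qed.

Lemma transient_bellman (gamma : R) (r v : S -> R) (j : 'I_m) :
  (forall s, v s = r s + gamma * \sum_y P s y * v y) ->
  restriction v (T j) = effective_reward P gamma r v T Rc j
    + gamma *: (block P (T j) (T j) *m restriction v (T j)).
Proof.
move=> v_eq; apply/colP => i.
rewrite /effective_reward -addrA -scalerDr 3!mxE v_eq sum_over_classes mxE.
congr (_ + _ * _); rewrite 2!mxE block_mulE !summxE addrAC; congr (_ + _); last first.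
  by apply: eq_bigr => k _; rewrite block_mulE.
rewrite (bigD1 j)//= addrC; congr (_ + _).
under [RHS]eq_bigr do rewrite block_mulE.
(* The effective reward sums over k > j only: by the ordering of the transient
   classes, P vanishes from T j to T k when k < j. *)
rewrite big_mkcond [RHS]big_mkcond; apply: eq_bigr => k _.
case: (ltngtP j k) => [jk|kj|jk]; last by rewrite -(val_inj jk) eqxx.
  by rewrite eq_sym neq_ltn jk.
rewrite neq_ltn kj /= big1// => y yT.
by rewrite (transient_order classes kj (enum_valP i) yT) mul0r.
Qed.

End ClassDecomposition.

Theorem theorem3 (R : realType) (S A : finType) (M : finMDP R S A)
  (pi : S -> A) (gamma : R)
  (d : measure_display) (Omega : measurableType d)
  (Pr : S -> probability Omega R) (X : nat -> Omega -> S)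
  (m l : nat) (T : 'I_m -> {set S}) (Rc : 'I_l -> {set S})
  (P : S -> S -> R) (r v : S -> R)
  (P_def : P = policy_trans M pi)
  (r_def : r = policy_reward M pi)
  (v_def : v = value_function gamma r Pr X)
  (r_ge0 : forall s, 0 <= r s)
  (gamma_range : 0 <= gamma < 1)
  (chain : markov_chain P Pr X)
  (classes : class_decomposition P Pr X T Rc) :
  (forall (k : 'I_l) (mu : 'rV[R]_#|Rc k|),
     stationary (block P (Rc k) (Rc k)) mu ->
     0 < wsum (restriction r (Rc k)) mu ->
     exists w : 'rV[R]_#|Rc k|,
       pagerank (time_reversal (block P (Rc k) (Rc k)) mu) gamma
         (restart (restriction r (Rc k)) mu) w /\
       forall i, restriction v (Rc k) i 0 =
         wsum (restriction r (Rc k)) mu / (1 - gamma) * (w 0 i / mu 0 i))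
  /\
  (forall (j : 'I_m) (Q : 'M[R]_#|T j|) (lambda : R)
     (nu : 'rV[R]_#|T j|) (h rt : 'cV[R]_#|T j|),
     Q = block P (T j) (T j) ->
     lambda = spectral_radius Q ->
     0 < lambda < 1 ->
     quasi_stationary Q nu ->
     right_eigenvector Q nu h ->
     rt = effective_reward P gamma r v T Rc j ->
     0 < wsum rt nu ->
     exists w : 'rV[R]_#|T j|,
       pagerank (time_reversal (doob Q h) (doob_stationary nu h))
         (gamma * lambda) (restart rt nu) w /\
       forall i, restriction v (T j) i 0 =
         wsum rt nu / (1 - gamma * lambda) * (w 0 i / nu 0 i)).
Proof.
subst P r v; set P := policy_trans M pi in chain classes *.
set r := policy_reward M pi in r_ge0 *; set v := value_function gamma r Pr X.
have P_ge0 x y : 0 <= P x y by exact: trans_ge0.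
have P_sum1 x : \sum_y P x y = 1 by exact: trans_sum1.
have v_eq s : v s = r s + gamma * \sum_y P s y * v y by exact: bellman.
have v_ge0 s : 0 <= v s by exact: (value_function_ge0 (P := P)).
have /andP[gamma_ge0 gamma_lt1] := gamma_range.
split=> [k mu mu_stat r_gt0|j Q lambda nu h rt Q_def lambda_def lambda_range nu_qs h_eig rt_def rt_gt0].
  have [classC C_rec] := recurrent_class classes k.
  have C_closed x y : x \in Rc k -> 0 < P x y -> y \in Rc k.
    move=> xC Pxy; rewrite (communicating_class_connect y classC xC).
    apply/andP; split; first exact: connect1.
    exact: (recurrent_closed chain (C_rec x xC) Pxy).
  have mu_gt0 := stationary_gt0 P_ge0 classC C_closed mu_stat.
  have [_ muP] := mu_stat.
  have := @pagerank_of_bellman R _ (block P (Rc k) (Rc k))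
    (time_reversal (block P (Rc k) (Rc k)) mu) gamma 1 mu
    (restriction r (Rc k)) (restriction v (Rc k)).
  rewrite mulr1; apply=> //.
  - by move=> i i'; rewrite mxE.
  - by rewrite scale1r -muP.
  - by move=> i i'; rewrite time_reversalE// invr1 mul1r.
  - by move=> i; rewrite mxE.
  - by move=> i; rewrite mxE.
  - exact: closed_bellman.
have /andP[lambda_gt0 lambda_lt1] := lambda_range.
have [_ nu_gt0 nuQ] := nu_qs; have [h_gt0 _ _] := h_eig.
rewrite -lambda_def in nuQ.
apply: (@pagerank_of_bellman R _ Q _ gamma lambda nu rt (restriction v (T j))) => //.
- by move=> i i'; rewrite Q_def mxE.
- by rewrite mulr_ge0 ?(ltW lambda_gt0)//= (le_lt_trans _ lambda_lt1)// ler_piMl// ltW.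
- by move=> i i'; rewrite time_reversal_doobE -?lambda_def// gt_eqF.
- move=> i; rewrite rt_def /effective_reward !mxE addr_ge0// mulr_ge0// !summxE.
  rewrite addr_ge0//; apply: sumr_ge0 => k _; rewrite block_mulE sumr_ge0// => y _;
  exact: mulr_ge0.
- by move=> i; rewrite mxE.
- by rewrite Q_def rt_def; exact: (transient_bellman classes).
Qed.
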